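(* Let $A$ and $B$ be $n\times n$ complex positive semidefinite matrices. Let $q\in[0,1]$, and let $C(q):=qA+(1-q)B$ (so that $C(1-q)=(1-q)A+qB$). Then, for all $k=1,\ldots,n$, $$\lambda_k(AB)\le\lambda_k\big(C(q)\,C(1-q)\big).$$
   Context: For any $n\times n$ matrix $M$ with real eigenvalues, $\lambda_k(M)$ denotes the $k$-th eigenvalue of $M$ when the eigenvalues are sorted in non-ascending order and counted with (algebraic) multiplicity: $\lambda_1(M)\ge\cdots\ge\lambda_n(M)$. Positive semidefinite matrices are understood to be Hermitian. A product of two positive semidefinite matrices is in general not Hermitian but has real (non-negative) eigenvalues, so the notation $\lambda_k$ applies to $AB$ and to $C(q)C(1-q)$. *)

(* Defs.v *)
From HB Require Import structures.
From mathcomp Require Import all_boot all_order all_algebra.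
From mathcomp Require Import sesquilinear spectral complex reals.

Set Implicit Arguments.
Unset Strict Implicit.
Unset Printing Implicit Defensive.

Import Order.TTheory GRing.Theory Num.Theory.
Local Open Scope ring_scope.
Local Open Scope sesquilinear_scope.
Local Open Scope complex_scope.

(* In the order of R[i], 0 <= z means that z is real and nonnegative. *)
Definition psdmx (R : realType) (n : nat) (M : 'M[R[i]]_n) : Prop :=
  M \is hermsymmx /\ forall v : 'cV[R[i]]_n, 0 <= (v^t* *m M *m v) 0 0.

(* All roots of the characteristic polynomial, in an unspecified order and
   repeated according to algebraic multiplicity. *)
Definition eigvals (R : realType) (n : nat) (M : 'M[R[i]]_n) : seq R[i] :=
  sval (closed_field_poly_normal (char_poly M)).

(* The index k is counted from 0: lambda M 0 is the largest eigenvalue.  Only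
   meant for M with real eigenvalues, for which Re forgets nothing (lambdaE);
   this covers products of two positive semidefinite matrices
   (eigvals_psdmx_mul). *)
Definition lambda (R : realType) (n : nat) (M : 'M[R[i]]_n) (k : 'I_n) : R :=
  (sort >=%R [seq complex.Re z | z <- eigvals M])`_k.

Definition mixmx (R : realType) (n : nat) (A B : 'M[R[i]]_n) (q : R) :
    'M[R[i]]_n :=
  q%:C *: A + (1 - q)%:C *: B.

Lemma char_poly_eigvals (R : realType) (n : nat) (M : 'M[R[i]]_n) :
  char_poly M = \prod_(z <- eigvals M) ('X - z%:P).
Proof.
rewrite /eigvals; case: closed_field_poly_normal => s /= {1}->.
by rewrite (monicP (char_poly_monic M)) scale1r.
Qed.

Lemma size_eigvals (R : realType) (n : nat) (M : 'M[R[i]]_n) :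
  size (eigvals M) = n.
Proof.
have := size_char_poly M; rewrite char_poly_eigvals.
by rewrite size_prod_XsubC => -[].
Qed.

Lemma mem_eigvals (R : realType) (n : nat) (M : 'M[R[i]]_n) (z : R[i]) :
  (z \in eigvals M) = eigenvalue M z.
Proof. by rewrite eigenvalue_root_char char_poly_eigvals root_prod_XsubC. Qed.

Lemma lambdaE (R : realType) (n : nat) (M : 'M[R[i]]_n) (s : seq R) :
  sorted >=%R s -> char_poly M = \prod_(x <- s) ('X - (x%:C)%:P) ->
  forall k : 'I_n, lambda M k = s`_k.
Proof.
move=> s_sorted; rewrite char_poly_eigvals => Ms k; rewrite /lambda.
have /perm_map-/(_ _ (@complex.Re R)) : perm_eq (eigvals M) [seq x%:C | x <- s].
  apply: prod_XsubC_eq; rewrite Ms big_map; exact: eq_bigr.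
rewrite -map_comp map_id_in => [|x _ //] Mps.
congr nth; apply: (sorted_eq (leT := >=%R)) => //.
- by move=> x y z yx xz; apply: le_trans xz yx.
- by move=> x y; rewrite andbC => /le_anti.
- by apply: sort_sorted => x y; apply: le_total.
- by rewrite perm_sort.
Qed.

Lemma psdmx_mulmx0 (R : realType) (n : nat) (M : 'M[R[i]]_n) (v : 'rV[R[i]]_n) :
  psdmx M -> (v *m M *m v^t*) 0 0 = 0 -> v *m M = 0.
Proof.
move=> [/is_hermitianmxP]; rewrite expr0 scale1r => Mh M_ge0 vMv0.
have ge0 (x : 'rV[R[i]]_n) : 0 <= (x *m M *m x^t*) 0 0.
  by have := M_ge0 (x^t*); rewrite trmxCK.
set w := v *m M.
have wwE : w *m w^t* = w *m M *m v^t*.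
  by rewrite {2}/w trmx_mul map_mxM /= -Mh mulmxA.
set a := (w *m w^t*) 0 0; set b := (w *m M *m w^t*) 0 0.
have a_ge0 : 0 <= a.
  by rewrite /a mxE; apply: sumr_ge0 => j _; rewrite !mxE mul_conjC_ge0.
have [a0|a_neq0] := eqVneq a 0.
  apply/rowP => j; rewrite [RHS]mxE; apply/eqP; rewrite -mul_conjC_eq0.
  apply/eqP; move: a0; rewrite /a mxE => /eqP; rewrite psumr_eq0 => [|l _].
    by move=> /allP/(_ j (mem_index_enum _)); rewrite !mxE => /eqP.
  by rewrite !mxE mul_conjC_ge0.
have b_ge0 : 0 <= b := ge0 w.
have b1_gt0 : 0 < b + 1 by rewrite ltr_wpDl.
have ab_gt0 : 0 < a / (b + 1) by rewrite divr_gt0 // lt_neqAle eq_sym a_neq0.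
have [t t_gt0 aE] : exists2 t, 0 < t & a = t * b + t.
  by exists (a / (b + 1)); rewrite // -[X in _ + X]mulr1 -mulrDr divfK ?gt_eqF.
have tC : Num.conj t = t by apply/CrealP; apply: gtr0_real.
have := ge0 (v - t *: w).
have -> : (v - t *: w)^t* = v^t* - t *: w^t*.
  by apply/matrixP => i j; rewrite !mxE rmorphB rmorphM /= tC.
rewrite mulmxBl mulmxBr !mulmxBl -!scalemxAl -!scalemxAr -wwE -/w.
have mxB (x y : 'M[R[i]]_1) : (x - y) 0 0 = x 0 0 - y 0 0 by rewrite !mxE.
have mxZ (x : 'M[R[i]]_1) : (t *: x) 0 0 = t * x 0 0 by rewrite mxE.
rewrite !(mxB, mxZ) vMv0 -/a -/b sub0r -mulrBr -opprD -mulrDr oppr_ge0.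
rewrite pmulr_rle0 // => le0.
have : a + (a - t * b) <= 0 by [].
have -> : a - t * b = t by rewrite aE addrC addKr.
by rewrite lt_geF // ltr_wpDl.
Qed.

Lemma eigvals_psdmx_mul (R : realType) (n : nat) (A B : 'M[R[i]]_n) :
  psdmx A -> psdmx B -> {in eigvals (A *m B), forall z, 0 <= z}.
Proof.
move=> psdA [_ B_ge0] z; rewrite mem_eigvals => /eigenvalueP[v vAB v_neq0].
have [/is_hermitianmxP] := psdA; rewrite expr0 scale1r => Ah A_ge0.
have vAv_ge0 : 0 <= (v *m A *m v^t*) 0 0.
  by have := A_ge0 (v^t*); rewrite trmxCK.
have [vAv0|vAv_neq0] := eqVneq ((v *m A *m v^t*) 0 0) 0.
  move: vAB; rewrite mulmxA (psdmx_mulmx0 psdA vAv0) mul0mx => /esym/eqP.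
  by rewrite scaler_eq0 (negPf v_neq0) orbF => /eqP ->.
have vAv_gt0 : 0 < (v *m A *m v^t*) 0 0 by rewrite lt_neqAle eq_sym vAv_neq0.
have := B_ge0 ((v *m A)^t*); rewrite trmxCK trmx_mul map_mxM /= -Ah.
by rewrite mulmxA -(mulmxA v) vAB -!scalemxAl mxE pmulr_lge0.
Qed.

(* Main.v *)
(* For hermitian T, c <= lambda_k(T) means that T - c is nonnegative on some
   subspace of dimension k, and lambda_k(M N) = lambda_k(R* N R) if M = R R*.
   For c = mu^2 > 0 this can be read off the block matrix [[M, mu], [mu, N]],
   whose form at (x, y) is computed in two ways:
   - it equals |x R + mu v|^2 + v (R* N R - mu^2) v* if y = v R*;
   - completing the square along the diagonal x = y, it equals a form in
     K^-1 plus the form of E = N - Y K^-1 Y at y - x, where Y = N + mu and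
     K = M + N + 2 mu.
   Hence mu^2 <= lambda_k(M N) means that E is nonnegative on some subspace of
   dimension k.  Going from (A, B) to (C(q), C(1-q)) leaves K unchanged and
   adds q (1 - q) (A - B) K^-1 (A - B), which is nonnegative, to E. *)

Require Import Defs.
From mathcomp Require Import all_boot all_order all_algebra.
From mathcomp Require Import sesquilinear spectral complex reals ring.

Set Implicit Arguments.
Unset Strict Implicit.
Unset Printing Implicit Defensive.

Import Order.TTheory GRing.Theory Num.Theory.
Local Open Scope ring_scope.
Local Open Scope sesquilinear_scope.
Local Open Scope complex_scope.

(* Identities that are linear in the maximal products. *)
Ltac linear_mx :=
  repeat move: (_ *m _) => ?;
  apply/matrixP => ? ?; rewrite !mxE; ring.

(** * Conjugate transposes and nonnegative forms *)

Section ConjugateTranspose.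
Variable C : numClosedFieldType.

Lemma trmxCM m n p (A : 'M[C]_(m, n)) (B : 'M_(n, p)) :
  (A *m B)^t* = B^t* *m A^t*.
Proof. by rewrite trmx_mul map_mxM. Qed.

Lemma trmxCD m n (A B : 'M[C]_(m, n)) : (A + B)^t* = A^t* + B^t*.
Proof. by rewrite linearD map_mxD. Qed.

Lemma trmxCN m n (A : 'M[C]_(m, n)) : (- A)^t* = - A^t*.
Proof. by rewrite linearN map_mxN. Qed.

Lemma trmxCZ m n (a : C) (A : 'M[C]_(m, n)) :
  a \is Num.real -> (a *: A)^t* = a *: A^t*.
Proof.
by move=> /CrealP aC; apply/matrixP => i j; rewrite !mxE rmorphM /= aC.
Qed.

Lemma trmxC_scalar n (a : C) : a \is Num.real -> (a%:M : 'M_n)^t* = a%:M.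
Proof. by move=> /CrealP aC; rewrite tr_scalar_mx map_scalar_mx /= aC. Qed.

Lemma trmxC_inv n (A : 'M[C]_n) : A^t* = A -> (invmx A)^t* = invmx A.
Proof. by move=> hA; rewrite trmx_inv map_invmx hA. Qed.

Lemma mulmxC_le0 m n (x : 'M[C]_(m, n)) i :
  (x *m x^t*) i i <= 0 -> row i x = 0.
Proof.
rewrite mxE => s_le0; apply/rowP => j; rewrite !mxE; apply/eqP.
have ge0 l : 0 <= x i l * x^t* l i by rewrite !mxE mul_conjC_ge0.
have /eqP : \sum_l x i l * x^t* l i == 0.
  by rewrite eq_le s_le0 sumr_ge0.
move=> /eqP; rewrite psumr_eq0 // => /allP/(_ j (mem_index_enum _)).
by rewrite !mxE mul_conjC_eq0.
Qed.

(** Row vectors are used, and hermitian symmetry is kept apart as [M^t* = M]; [psdmxP] links both to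
    [psdmx]. *)
Definition mxnonneg n (M : 'M[C]_n) : Prop :=
  forall v : 'rV_n, 0 <= (v *m M *m v^t*) 0 0.

Lemma mxnonnegD n (M N : 'M[C]_n) :
  mxnonneg M -> mxnonneg N -> mxnonneg (M + N).
Proof. by move=> M0 N0 v; rewrite mulmxDr mulmxDl mxE addr_ge0. Qed.

Lemma mxnonnegZ n (a : C) (M : 'M[C]_n) :
  0 <= a -> mxnonneg M -> mxnonneg (a *: M).
Proof. by move=> a0 M0 v; rewrite -scalemxAr -scalemxAl mxE mulr_ge0. Qed.

Lemma mxnonneg_congr m n (X : 'M[C]_(m, n)) (M : 'M[C]_n) :
  mxnonneg M -> mxnonneg (X *m M *m X^t*).
Proof. by move=> M0 v; have := M0 (v *m X); rewrite trmxCM !mulmxA. Qed.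

Lemma mxnonneg_gram m n (X : 'M[C]_(m, n)) : mxnonneg (X *m X^t*).
Proof.
move=> v; rewrite mulmxA -mulmxA -trmxCM mxE sumr_ge0 // => j _.
by rewrite !mxE mul_conjC_ge0.
Qed.

Lemma mxnonneg_scalar n (a : C) : 0 <= a -> mxnonneg (a%:M : 'M_n).
Proof.
move=> a0 v; rewrite mul_mx_scalar -scalemxAl mxE mulr_ge0 //.
rewrite mxE sumr_ge0 // => j _.
by rewrite !mxE mul_conjC_ge0.
Qed.

(** The form of [M + a] at [v] is at least [a |v|^2]. *)
Lemma mxnonneg_shift_eq0 n (M : 'M[C]_n) (a : C) (v : 'rV_n) :
  mxnonneg M -> 0 < a -> (v *m (M + a%:M) *m v^t*) 0 0 <= 0 -> v = 0.
Proof.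
move=> M0 a0; rewrite mulmxDr mulmxDl mul_mx_scalar -scalemxAl mxE => le0.
rewrite -(row_id 0 v); apply: mulmxC_le0; rewrite -(pmulr_rle0 _ a0).
apply: le_trans le0; rewrite [X in _ <= _ + X]mxE lerDr; exact: M0.
Qed.

Lemma mxnonneg_shift_unit n (M : 'M[C]_n) (a : C) :
  mxnonneg M -> 0 < a -> M + a%:M \in unitmx.
Proof.
move=> M0 a0; rewrite -row_free_unit; apply: inj_row_free => v vM0.
by apply: mxnonneg_shift_eq0 M0 a0 _; rewrite vM0 mul0mx mxE.
Qed.

(** The inverse is a congruence of [M] by itself: [M^-1 = M^-1 M (M^-1)^t*]. *)
Lemma mxnonneg_inv n (M : 'M[C]_n) :
  M^t* = M -> M \in unitmx -> mxnonneg M -> mxnonneg (invmx M).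
Proof.
move=> hM uM M0; rewrite -[invmx M]mulmx1 -(mulmxV uM) mulmxA.
by rewrite -{2}(trmxC_inv hM); apply: mxnonneg_congr.
Qed.

(** The subspace is given by a basis, the rows of [V]. *)
Definition nonneg_on_dim m n (T : 'M[C]_n) : Prop :=
  exists2 V : 'M[C]_(m, n), row_free V & mxnonneg (V *m T *m V^t*).

Lemma nonneg_on_dimD m n (S T : 'M[C]_n) :
  mxnonneg T -> nonneg_on_dim m S -> nonneg_on_dim m (S + T).
Proof.
move=> T0 [V freeV SV]; exists V => //.
by rewrite mulmxDr mulmxDl; apply: mxnonnegD => //; apply: mxnonneg_congr.
Qed.

(** * Characteristic polynomials of products *)

(** The determinant of [[[X, a], [b, 1]]] is computed by eliminating either off-diagonal block; the
    second elimination costs a factor [X^n], cancelled at the end. *)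
Lemma char_poly_mulmxC n (A B : 'M[C]_n) :
  char_poly (A *m B) = char_poly (B *m A).
Proof.
rewrite /char_poly /char_poly_mx !map_mxM /=.
set a := map_mx polyC A; set b := map_mx polyC B.
have det_l : \det (block_mx ('X%:M) a b 1%:M) = \det ('X%:M - a *m b).
  have -> : block_mx ('X%:M) a b 1%:M =
      block_mx 1%:M a 0 1%:M *m block_mx ('X%:M - a *m b) 0 b 1%:M.
    rewrite mulmx_block !(mul1mx, mulmx1, mul0mx, mulmx0, addr0, add0r).
    by rewrite subrK.
  by rewrite det_mulmx det_ublock det_lblock !det1 !(mul1r, mulr1).
have det_r : 'X ^+ n * \det (block_mx ('X%:M) a b 1%:M) =
             'X ^+ n * \det ('X%:M - b *m a).
  have <- : \det (block_mx (1%:M : 'M[{poly C}]_n) 0 (- b) ('X%:M : 'M_n))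
     = 'X ^+ n.
    by rewrite det_lblock det1 mul1r det_scalar.
  rewrite -det_mulmx mulmx_block.
  rewrite !(mul1mx, mulmx1, mul0mx, mulmx0, addr0, add0r) mulNmx.
  rewrite mul_mx_scalar mul_scalar_mx addNr mulNmx addrC.
  by rewrite det_ublock det_lblock det_scalar det1 mul1r.
have XnE : ('X ^+ n : {poly C}) != 0 by rewrite expf_neq0 // polyX_eq0.
by apply: (mulfI XnE); rewrite -det_l det_r.
Qed.

(** * The block form and its Schur complement *)

(** [N - Y K^-1 Y] is the Schur complement of [K] in [[[K, Y], [Y, N]]]. The identity is between [m]
    by [m] matrices, so that a whole basis is handled at once. *)
Lemma complete_square m n (x w : 'M[C]_(m, n)) (K Y N : 'M_n) :
    K \in unitmx -> K^t* = K -> Y^t* = Y ->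
  x *m K *m x^t* + x *m Y *m w^t* + w *m Y *m x^t* + w *m N *m w^t* =
  (x *m K + w *m Y) *m invmx K *m (x *m K + w *m Y)^t* +
  w *m (N - Y *m invmx K *m Y) *m w^t*.
Proof.
move=> uK hK hY.
rewrite trmxCD !trmxCM hK hY [_ *m invmx K]mulmxDl mulmxK // !mulmxDr !mulmxDl.
rewrite mulmxN mulNmx !mulmxA mulmxKV //; linear_mx.
Qed.

(** The change of variables [y = x + w] in the form of [[[M, mu], [mu, N]]] at [(x, y)] prepares
    [complete_square]. *)
Lemma block_form_shift m n (x w : 'M[C]_(m, n)) (M N : 'M_n) (mu : C) :
  x *m M *m x^t* + mu *: (x *m (x + w)^t*) + mu *: ((x + w) *m x^t*) +
    (x + w) *m N *m (x + w)^t* =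
  x *m (M + mu%:M + (N + mu%:M)) *m x^t* + x *m (N + mu%:M) *m w^t* +
    w *m (N + mu%:M) *m x^t* + w *m N *m w^t*.
Proof.
rewrite !trmxCD !(mulmxDl, mulmxDr) !mul_mx_scalar -!scalemxAl; linear_mx.
Qed.

(** At [y = v R^t*] the cross terms complete a square, whose surplus [mu^2 v v^t*] is subtracted in
    the second summand. *)
Lemma block_form_factor m n (x v : 'M[C]_(m, n)) (R N : 'M_n) (mu : C) :
    mu \is Num.real ->
  x *m (R *m R^t*) *m x^t* + mu *: (x *m (v *m R^t*)^t*) +
    mu *: (v *m R^t* *m x^t*) + v *m R^t* *m N *m (v *m R^t*)^t* =
  (x *m R + mu *: v) *m (x *m R + mu *: v)^t* +
    v *m (R^t* *m N *m R - (mu ^+ 2)%:M) *m v^t*.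
Proof.
move=> mu_real; rewrite trmxCD trmxCZ // !trmxCM trmxCK mulmxBr mulmxBl.
rewrite !(mulmxDl, mulmxDr) -?scalemxAl -?scalemxAr -?scalemxAl mul_mx_scalar.
rewrite -?scalemxAl !mulmxA; linear_mx.
Qed.

(** With [K = X + Y], the products [X K^-1 X], [Y K^-1 X] and [Y K^-1 Y] all reduce to [X], [Y] and
    the parallel sum [X K^-1 Y], after which the identity is linear. *)
Lemma schur_form_mix n (X Y N : 'M[C]_n) (s : C) :
    X + Y \in unitmx ->
  N + s *: (X - Y) -
      (Y + s *: (X - Y)) *m invmx (X + Y) *m (Y + s *: (X - Y)) =
  N - Y *m invmx (X + Y) *m Y +
    (s * (1 - s)) *: ((X - Y) *m invmx (X + Y) *m (X - Y)).
Proof.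
move=> uK; set K := X + Y in uK *.
have XKX : X *m invmx K *m X = X - X *m invmx K *m Y.
  by rewrite -{3}[X](mulmxKV uK) -mulmxBr /K addrK.
have YKX : Y *m invmx K *m X = X - X *m invmx K *m X.
  by rewrite -{2}[X](mulKVmx uK) mulmxA -!mulmxBl /K addrAC subrr add0r.
have YKY : Y *m invmx K *m Y = Y - X *m invmx K *m Y.
  by rewrite -{3}[Y](mulKVmx uK) mulmxA -!mulmxBl /K addrAC subrr add0r.
have YKX' : Y *m invmx K *m X = X *m invmx K *m Y.
  by rewrite YKX XKX opprB addrC subrK.
rewrite !(mulmxDl, mulmxDr, mulmxN, mulNmx) -?scalemxAl -?scalemxAr.
rewrite !(mulmxDl, mulmxDr, mulmxN, mulNmx) -?scalemxAl -?scalemxAr.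
rewrite YKX' XKX YKY; linear_mx.
Qed.

(** In each direction [x] is chosen so that the square next to the target form in [formE] vanishes,
    while the other square is nonnegative. It remains to see that the new basis is free. *)
Lemma nonneg_on_dim_schur m n (R N : 'M[C]_n) (mu : C) :
    N^t* = N -> mxnonneg N -> 0 < mu ->
  let M := R *m R^t* in let X := M + mu%:M in let Y := N + mu%:M in
  let K := X + Y in
  nonneg_on_dim m (R^t* *m N *m R - (mu ^+ 2)%:M) <->
  nonneg_on_dim m (N - Y *m invmx K *m Y).
Proof.
move=> hN N_ge0 mu_gt0 M X Y K.
have mu_real : mu \is Num.real := gtr0_real mu_gt0.
have hM : M^t* = M by rewrite /M trmxCM trmxCK.
have M_ge0 : mxnonneg M by exact: mxnonneg_gram.
have hK : K^t* = K by rewrite /K /X /Y !trmxCD !trmxC_scalar // hM hN.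
have hY : Y^t* = Y by rewrite /Y !trmxCD !trmxC_scalar // hN.
have uX : X \in unitmx by exact: mxnonneg_shift_unit.
have KE : K = M + N + (mu + mu)%:M by rewrite /K /X /Y addrACA -raddfD.
have mu2_gt0 : 0 < mu + mu by rewrite addr_gt0.
have MN_ge0 : mxnonneg (M + N) by exact: mxnonnegD.
have uK : K \in unitmx by rewrite KE; apply: mxnonneg_shift_unit.
have iK_ge0 : mxnonneg (invmx K).
  apply: mxnonneg_inv => //; rewrite KE.
  by apply: mxnonnegD => //; apply/mxnonneg_scalar/ltW.
have formE (x w v : 'M[C]_(m, n)) : x + w = v *m R^t* ->
    (x *m R + mu *: v) *m (x *m R + mu *: v)^t* +
      v *m (R^t* *m N *m R - (mu ^+ 2)%:M) *m v^t* =
    (x *m K + w *m Y) *m invmx K *m (x *m K + w *m Y)^t* +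
      w *m (N - Y *m invmx K *m Y) *m w^t*.
  move=> xwE; rewrite -complete_square // -block_form_factor // -xwE.
  exact: block_form_shift.
split=> [[V freeV V_ge0] | [W freeW W_ge0]].
  (* With this x the K^-1 term vanishes. *)
  set y := V *m R^t*; set x := - (y *m Y *m invmx X).
  exists (y - x).
    (* Here [(y - x) X = y X + y Y = y K], with [K] invertible, so [a y = 0]. *)
    apply: inj_row_free => a /(congr1 (mulmx^~ X)).
    rewrite mul0mx mulmxBr mulmxBl /x mulmxN mulNmx opprK !mulmxA mulmxKV //.
    rewrite -mulmxDr -/K => /(congr1 (mulmx^~ (invmx K))).
    rewrite mul0mx mulmxK // => ay0.
    apply: (row_free_inj freeV); rewrite mul0mx -(row_id 0 (a *m V)).
    apply: mulmxC_le0.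
    (* Since [a V R^t* = 0], the value at [a] is [- mu^2 |a V|^2], which is nonnegative only if
       [a V = 0]. *)
    have := V_ge0 a; rewrite mulmxBr mulmxBl mulmxBr mulmxBl !mulmxA.
    have -> : a *m V *m R^t* = 0 by move: ay0; rewrite /y ?mulmxA.
    rewrite !mul0mx sub0r mul_mx_scalar -!scalemxAl mxE oppr_ge0 mxE.
    by rewrite pmulr_rle0 ?exprn_gt0 // trmxCM mulmxA.
  have := formE x (y - x) V; rewrite addrC subrK => /(_ erefl).
  have -> : x *m K + (y - x) *m Y = 0.
    rewrite /K mulmxDr mulmxBl -addrA [x *m Y + _]addrC subrK.
    rewrite /x mulNmx mulmxKV //; exact: addNr.
  rewrite !mul0mx add0r => <-; apply: mxnonnegD V_ge0; exact: mxnonneg_gram.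
(* With these x and z the square |x R + mu z R|^2 vanishes. *)
have [z zX] : exists z, z *m X = W by exists (W *m invmx X); rewrite mulmxKV.
set x := - (mu *: z).
have yE : x + W = z *m R *m R^t*.
  by rewrite -zX /X mulmxDr mul_mx_scalar addrC addrK mulmxA.
have := formE x W (z *m R) yE.
rewrite [x *m R]mulNmx scalemxAl addNr mul0mx add0r => VE.
exists (z *m R); last first.
  by rewrite VE; apply: mxnonnegD => //; apply: mxnonneg_congr.
(* If [a z R = 0], the left side of [VE] vanishes at [a]. The [W] term is nonnegative, so the [K^-1]
   term, which is [mu^2] times the form of [K^-1] at [a W], is at most 0. *)
apply: inj_row_free => a azR0.
have aG : a *m (x *m K + W *m Y) = - (mu *: (a *m W)).
  have -> : x *m K + W *m Y = x *m X + z *m R *m R^t* *m Y.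
    by rewrite -yE /K -/X mulmxDr mulmxDl addrA.
  rewrite mulmxDr !mulmxA -(mulmxA a z) azR0 !mul0mx addr0.
  by rewrite mulmxN mulNmx -scalemxAr -scalemxAl -mulmxA zX.
have aVE : (a *m (z *m R *m (R^t* *m N *m R - (mu ^+ 2)%:M) *m (z *m R)^t*) *m
    a^t*) 0 0 = 0.
  rewrite -[z *m R *m _ *m _]mulmxA (mulmxA a (z *m R)) azR0.
  by rewrite !mul0mx mxE.
have formD (S T : 'M[C]_m) : (a *m (S + T) *m a^t*) 0 0 =
    (a *m S *m a^t*) 0 0 + (a *m T *m a^t*) 0 0.
  by rewrite mulmxDr mulmxDl mxE.
have : ((a *m (x *m K + W *m Y)) *m invmx K *m
    (a *m (x *m K + W *m Y))^t*) 0 0 <= 0.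
  rewrite -aVE VE formD trmxCM !mulmxA lerDl.
  by have := W_ge0 a; rewrite !mulmxA.
rewrite aG -scaleNr trmxCZ ?rpredN // -!scalemxAl -!scalemxAr scalerA mulrNN.
rewrite mxE pmulr_rle0 ?mulr_gt0 // => le0.
(* The form of [K^-1] at [a W] is the form of [K] at [a W K^-1], and [K] is definite, being [M + N]
   plus a positive scalar. *)
have /(congr1 (mulmx^~ K)) : a *m W *m invmx K = 0.
  apply: mxnonneg_shift_eq0 MN_ge0 mu2_gt0 _.
  by rewrite -KE mulmxKV // trmxCM trmxC_inv // mulmxA.
rewrite mulmxKV // mul0mx => aW0; apply: (row_free_inj freeW).
by rewrite mul0mx.
Qed.

End ConjugateTranspose.

(** * Ordered eigenvalues and subspaces *)

(** In a non-increasing sequence the entries that are at least [c] form a prefix; positions start at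
    0, hence the strict comparison. *)
Lemma sorted_nth_count (R : realDomainType) (s : seq R) (c : R) (k : nat) :
  sorted >=%R s -> (k < size s)%N ->
  (c <= s`_k) = (k < count (fun x => c <= x)%R s)%N.
Proof.
elim: s k => // x s IHs k /= s_sorted; have [cx|xc] := boolP (c <= x).
  case: k => //= k; rewrite ltnS add1n ltnS; apply: IHs.
  exact: path_sorted s_sorted.
have s_le : all (fun y => ~~ (c <= y)) s.
  move: s_sorted; rewrite path_sortedE => [/andP[/allP s_le _]|]; last first.
    by move=> a b d ba ad; apply: le_trans ad ba.
  apply/allP => y /s_le yx; apply: contra xc => cy; exact: le_trans cy yx.
rewrite add0n => k_lt.
have -> : count (fun x => c <= x)%R s = 0%N.
  by apply/eqP; rewrite -leqn0 leqNgt -has_count -all_predC.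
rewrite ltn0; apply/negbTE; case: k k_lt => //= k k_lt.
exact: (allP s_le) (mem_nth _ _).
Qed.

Section Eigenvalues.
Variables (R : realType) (n : nat).
Implicit Types A B M N T : 'M[R[i]]_n.

Lemma psdmxP M : psdmx M <-> M^t* = M /\ mxnonneg M.
Proof.
split=> -[hM M0]; split.
- by move: hM => /is_hermitianmxP; rewrite expr0 scale1r.
- by move=> v; have := M0 (v^t*); rewrite trmxCK.
- by apply/is_hermitianmxP; rewrite expr0 scale1r hM.
- by move=> v; have := M0 (v^t*); rewrite trmxCK.
Qed.

Lemma form_diag_mx (C : numClosedFieldType) p (d u : 'rV[C]_p) :
  (u *m diag_mx d *m u^t*) 0 0 = \sum_i d 0 i * `|u 0 i| ^+ 2.
Proof.
rewrite mul_mx_diag mxE; apply: eq_bigr => i _.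
by rewrite !mxE normCK mulrAC mulrC.
Qed.

(** The spectral theorem, with the eigenvalues typed in [R] so that they can be ordered. *)
Lemma hermitian_diag M : M^t* = M ->
  exists P : 'M[R[i]]_n, exists d : 'I_n -> R,
  [/\ P *m P^t* = 1%:M, P^t* *m P = 1%:M &
      M = P^t* *m diag_mx (\row_i (d i)%:C) *m P].
Proof.
move=> hM; have Mherm : M \is hermsymmx.
  by apply/is_hermitianmxP; rewrite expr0 scale1r hM.
have /orthomx_spectralP ME := hermitian_normalmx Mherm.
have /unitarymxP PP := spectral_unitarymx M.
have PV := invmx_unitary (spectral_unitarymx M).
have dE : spectral_diag M = \row_i (complex.Re (spectral_diag M 0 i))%:C.
  apply/rowP => i; rewrite mxE.
  have /mxOverP/(_ 0 i) := hermitian_spectral_diag_real Mherm.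
  by move=> /Creal_ReP; rewrite complexRe.
exists (spectralmx M), (fun i => complex.Re (spectral_diag M 0 i)).
by split; [exact: PP|exact: mulmx1C|rewrite -dE -PV; exact: ME].
Qed.

Lemma psdmx_gram M : psdmx M -> exists S : 'M[R[i]]_n, M = S *m S^t*.
Proof.
move=> /psdmxP[hM M0]; have [P [d [PP' P'P ME]]] := hermitian_diag hM.
(* [d i] is the value of the form of [M] at row [i] of the unitary [P]. *)
have d_ge0 i : 0 <= (d i)%:C.
  have := M0 (row i P); rewrite {1}ME.
  have -> : row i P *m (P^t* *m diag_mx (\row_i (d i)%:C) *m P) *m
      (row i P)^t* =
    delta_mx 0 i *m diag_mx (\row_i (d i)%:C) *m (delta_mx 0 i)^t*.
    rewrite rowE trmxCM !mulmxA -(mulmxA _ P) PP' mulmx1.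
    by rewrite -(mulmxA _ P) PP' mulmx1.
  rewrite form_diag_mx (bigD1 i) //= big1 => [|j /negbTE ji].
    by rewrite !mxE !eqxx normr1 expr1n mulr1 addr0.
  by rewrite !mxE ji andbF normr0 expr0n mulr0.
exists (P^t* *m diag_mx (\row_i sqrtC (d i)%:C)).
rewrite trmxCM trmxCK tr_diag_mx map_diag_mx !mulmxA.
rewrite -(mulmxA _ (diag_mx _) (diag_mx _)) mulmx_diag.
rewrite [LHS]ME; congr (_ *m diag_mx _ *m _); apply/rowP => i; rewrite !mxE.
by rewrite /= geC0_conj ?sqrtC_ge0 // -expr2 sqrtCK.
Qed.

Lemma eq_char_poly_lambda M T (k : 'I_n) :
  char_poly M = char_poly T -> lambda M k = lambda T k.
Proof. by rewrite /lambda /eigvals => ->. Qed.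

Lemma lambda_ge0 M (k : 'I_n) :
  {in eigvals M, forall z, 0 <= z} -> 0 <= lambda M k.
Proof.
move=> M_ge0; rewrite /lambda; set s := sort _ _.
have := mem_nth 0 (_ : (k < size s)%N); rewrite /s.
rewrite size_sort size_map size_eigvals ltn_ord => /(_ isT).
rewrite mem_sort => /mapP[z /M_ge0 z_ge0 ->].
by move: z_ge0; case: z => a b; rewrite lecE => /andP[].
Qed.

(** Courant-Fischer: both sides mean that at least [k + 1] of the eigenvalues [d i] are at least
    [c], the index [k] being counted from 0. *)
Lemma lambda_geP T (c : R) (k : 'I_n) : T^t* = T ->
  c <= lambda T k <-> nonneg_on_dim k.+1 (T - (c%:C)%:M).
Proof.
move=> hT; have [P [d [PP' P'P TE]]] := hermitian_diag hT.
set e : 'rV[R[i]]_n := \row_i (d i - c)%:C.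
have TcE : T - (c%:C)%:M = P^t* *m diag_mx e *m P.
  have -> : diag_mx e = diag_mx (\row_i (d i)%:C) - (c%:C)%:M.
    rewrite -diag_const_mx -raddfB; congr diag_mx; apply/rowP => i.
    by rewrite !mxE rmorphB.
  by rewrite mulmxBr mulmxBl -TE mul_mx_scalar -scalemxAl P'P scalemx1.
have uP : P \in unitmx by case: (mulmx1_unit PP').
have uP' : P^t* \in unitmx by case: (mulmx1_unit PP').
pose I := [set i | c <= d i].
have -> : (c <= lambda T k) = (k < #|I|)%N.
  pose s := sort >=%R [seq d i | i <- enum 'I_n].
  have s_sorted : sorted >=%R s by apply: sort_sorted => x y; apply: le_total.
  rewrite (@lambdaE _ _ _ s) //; last first.
    rewrite TE -mulmxA char_poly_mulmxC -mulmxA PP' mulmx1.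
    rewrite char_poly_trig ?diag_mx_is_trig //.
    rewrite (perm_big [seq d i | i <- enum 'I_n]) ?perm_sort //= big_map enumT.
    by apply: eq_bigr => i _; rewrite !mxE eqxx.
  have size_s : size s = n by rewrite size_sort size_map size_enum_ord.
  rewrite sorted_nth_count ?size_s // count_sort count_map enumT cardE.
  rewrite /enum_mem size_filter; congr (_ < _)%N.
  by apply: eq_count => i; rewrite !inE.
split=> [k_lt | [V freeV V_ge0]].
  pose f (j : 'I_k.+1) := enum_val (widen_ord k_lt j).
  have f_inj : injective f.
    by move=> i j /enum_val_inj/(congr1 val) ij; apply: val_inj.
  have fI j : f j \in I by exact: enum_valP.
  (* The rows of [S P] are [k + 1] rows of [P], eigenvectors for eigenvalues that are at least
     [c]. *)
  pose S : 'M[R[i]]_(k.+1, n) := \matrix_(j, l) (f j == l)%:R.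
  exists (S *m P).
    apply: inj_row_free => a; rewrite mulmxA.
    move=> /(congr1 (fun x => x *m P^t*)); rewrite mul0mx.
    rewrite -(mulmxA (a *m S)) PP' mulmx1 => /rowP aS0.
    apply/rowP => j; have := aS0 (f j).
    rewrite !mxE (bigD1 j) //= big1 ?addr0 => [|l /negbTE lj].
      by rewrite mxE eqxx mulr1.
    by rewrite mxE (inj_eq f_inj) lj mulr0.
  move=> a; rewrite TcE trmxCM !mulmxA.
  have -> : a *m S *m P *m P^t* *m diag_mx e *m P *m P^t* *m S^t* *m a^t* =
      (a *m S) *m diag_mx e *m (a *m S)^t*.
    by rewrite trmxCM -(mulmxA _ P) PP' mulmx1 -(mulmxA _ P) PP' mulmx1 !mulmxA.
  rewrite form_diag_mx sumr_ge0 // => i _.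
  have [iI|iNI] := boolP (i \in I).
    move: iI; rewrite inE => iI.
    by rewrite mulr_ge0 ?exprn_ge0 // mxE ler0c subr_ge0.
  rewrite [(a *m S) 0 i]mxE big1 ?normr0 ?expr0n ?mulr0 // => j _.
  by rewrite mxE; case: eqP iNI => [<-|]; rewrite ?fI ?mulr0.
rewrite ltnNge; apply/negP => I_le.
(* [U] is the basis in eigencoordinates and [B] its columns in [I]. Having more rows than columns,
   [B] is killed by some nonzero [a]. *)
pose U := V *m P^t*.
pose B : 'M[R[i]]_(k.+1, #|I|) := \matrix_(j, l) U j (enum_val l).
have : kermx B != 0.
  rewrite kermx_eq0 /row_free neq_ltn.
  by rewrite (leq_ltn_trans (rank_leq_col B)).
move=> /rowV0Pn[a /sub_kermxP aB0 /negP[]]; apply/eqP.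
have aUI i : i \in I -> (a *m U) 0 i = 0.
  move=> iI; have /rowP/(_ (enum_rank_in iI i)) := aB0.
  rewrite [RHS]mxE => <-; rewrite !mxE; apply: eq_bigr => j _.
  by rewrite [B _ _]mxE enum_rankK_in.
have aU0 : a *m U = 0.
  have := V_ge0 a; rewrite TcE.
  have -> : a *m (V *m (P^t* *m diag_mx e *m P) *m V^t*) *m a^t* =
      (a *m U) *m diag_mx e *m (a *m U)^t*.
    by rewrite /U !trmxCM trmxCK !mulmxA.
  rewrite form_diag_mx -oppr_le0 -sumrN => sum_le0.
  have ge0 i : 0 <= - (e 0 i * `|(a *m U) 0 i| ^+ 2).
    have [iI|iNI] := boolP (i \in I).
      by rewrite aUI // normr0 expr0n mulr0 oppr0.
    rewrite -mulNr mulr_ge0 ?exprn_ge0 // mxE -rmorphN ler0c opprB subr_ge0.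
    by move: iNI; rewrite inE -ltNge => /ltW.
  have /eqP : \sum_i - (e 0 i * `|(a *m U) 0 i| ^+ 2) == 0.
    by rewrite eq_le sum_le0 sumr_ge0.
  move=> /eqP; rewrite psumr_eq0 // => /allP all0.
  apply/rowP => i; rewrite [RHS]mxE.
  have [iI|iNI] := boolP (i \in I); first exact: aUI.
  have := all0 i (mem_index_enum _).
  rewrite oppr_eq0 mulf_eq0 sqrf_eq0 normr_eq0.
  case/orP => /eqP // ei0; move: iNI; rewrite inE.
  move: ei0; rewrite mxE => /eqP; rewrite fmorph_eq0 subr_eq0 => /eqP ->.
  by rewrite lexx.
apply: (row_free_inj freeV); rewrite mul0mx.
rewrite -[a *m V](mulmxK uP').
have -> : a *m V *m P^t* = a *m U by rewrite mulmxA.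
by rewrite aU0 mul0mx.
Qed.

Lemma psdmx_mixmx A B (q : R) :
  psdmx A -> psdmx B -> 0 <= q -> q <= 1 -> psdmx (mixmx A B q).
Proof.
move=> /psdmxP[hA A0] /psdmxP[hB B0] q0 q1; apply/psdmxP.
have q1' : 0 <= 1 - q by rewrite subr_ge0.
split; last by apply: mxnonnegD; apply: mxnonnegZ => //; rewrite ler0c.
by rewrite trmxCD !trmxCZ ?hA ?hB // ger0_real // ler0c.
Qed.

Lemma lambda_psdmx_mul_geP M N (c : R) (k : 'I_n) :
    psdmx M -> psdmx N -> 0 < c ->
  let mu := (Num.sqrt c)%:C in let X := M + mu%:M in let Y := N + mu%:M in
  c <= lambda (M *m N) k <->
  nonneg_on_dim k.+1 (N - Y *m invmx (X + Y) *m Y).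
Proof.
move=> /psdmx_gram[S ->] /psdmxP[hN N_ge0] c_gt0 mu X Y.
have mu_gt0 : 0 < mu by rewrite ltcR sqrtr_gt0.
rewrite -(nonneg_on_dim_schur k.+1 S hN N_ge0 mu_gt0).
have -> : lambda (S *m S^t* *m N) k = lambda (S^t* *m N *m S) k.
  by apply: eq_char_poly_lambda; rewrite -mulmxA char_poly_mulmxC.
have -> : mu ^+ 2 = c%:C by rewrite -rmorphXn /= sqr_sqrtr // ltW.
by apply: lambda_geP; rewrite !trmxCM trmxCK hN mulmxA.
Qed.

End Eigenvalues.

Theorem theorem2 (R : realType) (n : nat) (A B : 'M[R[i]]_n) (q : R)
    (psdA : psdmx A) (psdB : psdmx B) (q_ge0 : 0 <= q) (q_le1 : q <= 1)
    (k : 'I_n) :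
  lambda (A *m B) k <= lambda (mixmx A B q *m mixmx A B (1 - q)) k.
Proof.
have p_ge0 : 0 <= 1 - q by rewrite subr_ge0.
have p_le1 : 1 - q <= 1 by rewrite gerBl.
have psdM := psdmx_mixmx psdA psdB q_ge0 q_le1.
have psdN := psdmx_mixmx psdA psdB p_ge0 p_le1.
have [c_le0|c_gt0] := leP (lambda (A *m B) k) 0.
  exact: le_trans c_le0 (lambda_ge0 k (eigvals_psdmx_mul psdM psdN)).
apply/(lambda_psdmx_mul_geP k psdM psdN c_gt0).
have /(lambda_psdmx_mul_geP k psdA psdB c_gt0) := lexx (lambda (A *m B) k).
set mu : R[i] := (Num.sqrt _)%:C.
have mu_gt0 : 0 < mu by rewrite ltcR sqrtr_gt0.
set X := A + mu%:M; set Y := B + mu%:M => AB_dim.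
have [/psdmxP[hA A_ge0] /psdmxP[hB B_ge0]] := (psdA, psdB).
set s : R[i] := (1 - q)%:C.
have s1 : 1 - s = q%:C by rewrite /s rmorphB rmorph1 subKr.
have NE : mixmx A B (1 - q) = B + s *: (X - Y).
  by rewrite /mixmx subKr -s1 -/s /X /Y; linear_mx.
have -> : mixmx A B q + mu%:M + (mixmx A B (1 - q) + mu%:M) = X + Y.
  by rewrite NE /mixmx -/s -s1 /X /Y; linear_mx.
have -> : mixmx A B (1 - q) + mu%:M = Y + s *: (X - Y).
  by rewrite NE /Y addrAC.
have mu2_gt0 : 0 < mu + mu by rewrite addr_gt0.
have XYE : X + Y = A + B + (mu + mu)%:M by rewrite /X /Y addrACA -raddfD.
have uXY : X + Y \in unitmx.
  rewrite XYE; exact: mxnonneg_shift_unit (mxnonnegD A_ge0 B_ge0) mu2_gt0.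
have mu_real : mu \is Num.real := gtr0_real mu_gt0.
have hX : X^t* = X by rewrite trmxCD trmxC_scalar // hA.
have hY : Y^t* = Y by rewrite trmxCD trmxC_scalar // hB.
rewrite NE (schur_form_mix B s uXY); apply: nonneg_on_dimD AB_dim.
apply: mxnonnegZ; first by rewrite s1 mulr_ge0 // ler0c.
have {2}-> : X - Y = (X - Y)^t* by rewrite trmxCD trmxCN hX hY.
apply/mxnonneg_congr/mxnonneg_inv; [by rewrite trmxCD hX hY|exact: uXY|].
rewrite XYE; apply: mxnonnegD (mxnonnegD A_ge0 B_ge0) _.
exact/mxnonneg_scalar/ltW.
Qed.
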